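(* Let $\rho$ be an $n$-qubit state with bipartition $A|B$. The $r_\alpha$-negativities satisfy $\mathcal{C}_\alpha(\rho)\ge\mathcal{C}_\beta(\rho)$ for all $0\le\alpha<\beta$ with $\alpha,\beta\ne2$; in particular $\mathcal{C}_\alpha(\rho)\le\mathcal{C}(\rho)$ for every $\alpha\ge1$, $\alpha\ne 2$. Moreover the CCNR negativity lower-bounds the robustness of entanglement: $\mathcal{C}(\rho)\le\ln\big(2\mathcal{R}(\rho)+1\big)$.
   Context: The realignment matrix $R_\rho$ is defined by $\langle a,a'|R_\rho|b,b'\rangle=\langle a,b|\rho|a',b'\rangle$ in the computational basis ($a,a'$ labels of $A$, $b,b'$ labels of $B$). The CCNR negativity is $\mathcal{C}(\rho)=\ln\|R_\rho\|_1$ (trace norm). The realignment moments are $r_\alpha(\rho)=\mathrm{tr}((R_\rho^\dagger R_\rho)^{\alpha/2})=\sum_i\lambda_i^\alpha$, summed over nonzero singular values $\lambda_i$ of $R_\rho$; $r_2=\mathrm{tr}(\rho^2)$. The $r_\alpha$-negativity is $\mathcal{C}_\alpha(\rho)=\frac{1}{2-\alpha}\ln r_\alpha+\frac{1-\alpha}{2-\alpha}\ln r_2$ ($\alpha\ne2$), so $\mathcal{C}_1=\mathcal{C}$. The robustness of entanglement is $\mathcal{R}(\rho)=\min\{s\ge0:\ \rho=(1+s)\rho^+-s\rho^-,\ \rho^+,\rho^-\in\mathrm{SEP}\}$, where SEP is the set of states separable across $A|B$. *)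

(* Defs.v *)
From HB Require Import structures.
From mathcomp Require Import all_boot all_order all_algebra.
From mathcomp Require Import spectral.
From mathcomp Require Import complex.
From mathcomp Require Import all_classical all_reals all_analysis.

Set Implicit Arguments.
Unset Strict Implicit.
Unset Printing Implicit Defensive.

Import Order.TTheory GRing.Theory Num.Theory.

Local Open Scope ring_scope.
Local Open Scope sesquilinear_scope.
Local Open Scope complex_scope.

(* The computational basis of the qubits in S is labelled by the bit strings
   indexed by S.  An operator on C^T, for a finite label type T, is a matrix
   of size #|T|, whose rows and columns are numbered through enum_rank. *)
Notation bits S := {ffun {i | i \in S} -> bool}.
Notation qbits n := {ffun 'I_n -> bool}.
Notation "''Op[' C ]( T )" := 'M[C]_#|{: T}|
  (at level 8, C at level 2, format "''Op[' C ]( T )") : type_scope.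

Definition mxat (C : Type) (T : finType) (X : 'Op[C](T)) (x y : T) : C :=
  X (enum_rank x) (enum_rank y).

Definition opmx (C : Type) (T : finType) (f : T -> T -> C) : 'Op[C](T) :=
  \matrix_(i, j) f (enum_val i) (enum_val j).

Section Qubits.
Variables (n : nat) (A : {set 'I_n}).

(* |a, b> for labels a of A and b of its complement; the last branch is
   never reached. *)
Definition join_bits (a : bits A) (b : bits (~: A)) : qbits n :=
  [ffun i => if (insub i : option {i | i \in A}) is Some u then a u
             else if (insub i : option {i | i \in ~: A}) is Some v then b v
             else false].

End Qubits.

Definition restr_bits (n : nat) (S : {set 'I_n}) (x : qbits n) : bits S :=
  [ffun u => x (val u)].

Section States.
Variable R : realType.

(* 0 <= z in R[i] means that z is real and nonnegative. *)
Definition density (d : nat) (rho : 'M[R[i]]_d) : Prop :=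
  [/\ rho \is hermsymmx,
      forall v : 'cV[R[i]]_d, 0 <= (v ^t* *m rho *m v) 0 0
    & \tr rho = 1].

(* Singular values, with multiplicity; the q of them include (q - p) extra
   zeros when p < q. *)
Definition sing_val (p q : nat) (M : 'M[R[i]]_(p, q)) (j : 'I_q) : R :=
  Num.sqrt (complex.Re (spectral_diag (M ^t* *m M) 0 j)).

Definition trace_norm (p q : nat) (M : 'M[R[i]]_(p, q)) : R :=
  \sum_j sing_val M j.

Section Bipartite.
Variables (n : nat) (A : {set 'I_n}).
Implicit Types rho : 'Op[R[i]](qbits n).

(* <a, a'| R_rho |b, b'> = <a, b| rho |a', b'> *)
Definition realign rho :
    'M[R[i]]_(#|{: bits A * bits A}|, #|{: bits (~: A) * bits (~: A)}|) :=
  \matrix_(i, j)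
    mxat rho (join_bits (enum_val i).1 (enum_val j).1)
             (join_bits (enum_val i).2 (enum_val j).2).

Definition ccnr_neg rho : R := ln (trace_norm (realign rho)).

(* The sum skips the zero singular values since 0 `^ 0 = 1. *)
Definition realign_moment (alpha : R) rho : R :=
  \sum_(j | sing_val (realign rho) j != 0) sing_val (realign rho) j `^ alpha.

Definition moment_neg (alpha : R) rho : R :=
  (2 - alpha)^-1 * ln (realign_moment alpha rho)
  + (1 - alpha) / (2 - alpha) * ln (realign_moment 2 rho).

Definition tensor_op (X : 'Op[R[i]](bits A)) (Y : 'Op[R[i]](bits (~: A))) :
    'Op[R[i]](qbits n) :=
  opmx (fun x y : qbits n =>
    mxat X (restr_bits A x) (restr_bits A y)
    * mxat Y (restr_bits (~: A) x) (restr_bits (~: A) y)).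

Definition separable rho : Prop :=
  exists (m : nat) (p : 'I_m -> R)
         (X : 'I_m -> 'Op[R[i]](bits A)) (Y : 'I_m -> 'Op[R[i]](bits (~: A))),
    [/\ forall k, 0 <= p k,
        \sum_k p k = 1,
        forall k, density (X k),
        forall k, density (Y k)
      & rho = \sum_k (p k)%:C *: tensor_op (X k) (Y k)].

(* The infimum of this set is its minimum: the set is nonempty (SEP spans the
   Hermitian operators) and closed (SEP is compact). *)
Definition robustness rho : R :=
  inf [set s : R | 0 <= s /\
    exists rhop rhom : 'Op[R[i]](qbits n),
      [/\ separable rhop, separable rhom
        & rho = (1 + s)%:C *: rhop - s%:C *: rhom]]%classic.

End Bipartite.
End States.

(* Main.v *)
Require Import Defs.
From HB Require Import structures.
From mathcomp Require Import all_boot all_order all_algebra.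
From mathcomp Require Import spectral.
From mathcomp Require Import complex.
From mathcomp Require Import all_classical all_reals all_analysis.
From mathcomp Require Import ring.

Set Implicit Arguments.
Unset Strict Implicit.
Unset Printing Implicit Defensive.

Import Order.TTheory GRing.Theory Num.Theory.

Local Open Scope ring_scope.
Local Open Scope sesquilinear_scope.
Local Open Scope complex_scope.

(* With the probability weights w_j = s_j^2 / r_2 on the nonzero singular values
   s_j of R_rho, C_alpha = ln r_2 + (ln E_w[(1/s)^p]) / p where p = 2 - alpha, so
   the monotonicity in alpha is the power mean inequality.

   For the robustness, duality gives a contraction K with
   tr (K R_rho) = ||R_rho||_1.  The realignment of X (x) Y is the rank-one matrix
   |X><Y^*|, and ||X||_2 <= tr X = 1 for a state X, so |tr (K R_sigma)| <= 1 for
   every separable sigma; hence ||R_rho||_1 <= (1 + s) + s whenever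
   rho = (1 + s) rho^+ - s rho^-.  Since the infimum of the empty set is 0 here,
   one also needs that such a decomposition exists: product states span the
   operators over C, hence the Hermitian operators over R. *)

(** * Power mean inequality in exponential form *)

Section LogSumExp.
Variables (R : realType) (I : finType) (P : pred I) (w : I -> R).
Hypothesis w_ge0 : forall i, P i -> 0 <= w i.
Hypothesis w_sum1 : \sum_(i | P i) w i = 1.

Definition log_sum_exp (a : I -> R) : R := ln (\sum_(i | P i) w i * expR (a i)).

Lemma sum_exp_gt0 (a : I -> R) : 0 < \sum_(i | P i) w i * expR (a i).
Proof.
have [i Pi wi] : exists2 i, P i & 0 < w i.
  apply/exists_inP; apply: contraT; rewrite negb_exists_in => /forall_inP w0.
  have : \sum_(i | P i) w i = 0.
    by apply: big1 => i Pi; apply/le_anti; rewrite w_ge0 // leNgt w0.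
  by rewrite w_sum1 => /eqP; rewrite oner_eq0.
rewrite (bigD1 i) //= ltr_wpDr ?mulr_gt0 ?expR_gt0 //.
by apply: sumr_ge0 => j /andP[Pj _]; rewrite mulr_ge0 ?w_ge0 ?expR_ge0.
Qed.

(** Jensen's inequality from the tangent line of [expR] at the mean [m]: the weights average
    [a i - m] to zero, so the tangent values average to [expR m]. *)
Lemma log_sum_exp_ge_mean (a : I -> R) :
  \sum_(i | P i) w i * a i <= log_sum_exp a.
Proof.
set m := \sum_(i | P i) w i * a i.
rewrite -[m]expRK /log_sum_exp ler_ln ?posrE ?expR_gt0 ?sum_exp_gt0 //.
have -> : expR m = \sum_(i | P i) w i * (expR m * (1 + (a i - m))).
  rewrite -[LHS]mulr1.
  under eq_bigr => i _ do rewrite mulrCA mulrDr mulr1 mulrBr.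
  by rewrite -mulr_sumr big_split /= sumrB -mulr_suml w_sum1 mul1r -/m subrr addr0.
apply: ler_sum => i Pi; apply: ler_wpM2l; first exact: w_ge0.
by rewrite -{2}[a i] (subrKC m) expRD ler_wpM2l ?expR_ge0 ?expR_ge1Dx.
Qed.

(** Subtracting [L] from every [a i] makes the [expR (a i - L)] average to 1. Convexity of [expR]
    between [a i - L] and 0 then bounds the average of [expR (t * (a i - L))] by t + (1 - t) = 1. *)
Lemma log_sum_exp_scale (t : R) (a : I -> R) : 0 <= t <= 1 ->
  log_sum_exp (fun i => t * a i) <= t * log_sum_exp a.
Proof.
move=> /andP[t_ge0 t_le1]; set L := log_sum_exp a.
rewrite -[t * L]expRK ler_ln ?posrE ?expR_gt0 ?sum_exp_gt0 //.
have LE : expR L = \sum_(i | P i) w i * expR (a i).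
  by rewrite lnK // posrE sum_exp_gt0.
have -> : expR (t * L) =
    \sum_(i | P i) w i * (expR (t * L) * (t * expR (a i - L) + (1 - t))).
  have termE i : w i * (expR (t * L) * (t * expR (a i - L) + (1 - t))) =
      expR (t * L) * (t / expR L * (w i * expR (a i)) + w i * (1 - t)).
    by rewrite expRB; ring.
  rewrite (eq_bigr _ (fun i _ => termE i)) -mulr_sumr big_split /=.
  rewrite -mulr_sumr -mulr_suml w_sum1 -LE divfK ?gt_eqF ?expR_gt0 //.
  by rewrite mul1r subrKC mulr1.
apply: ler_sum => i Pi; apply: ler_wpM2l; first exact: w_ge0.
have -> : expR (t * a i) = expR (t * L) * expR (t * (a i - L)).
  by rewrite -expRD; congr expR; ring.
rewrite ler_wpM2l ?expR_ge0 //.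
have /= := @convex_expR R (Itv01 t_ge0 t_le1) (a i - L) 0.
by rewrite !convRE /= expR0 mulr1 mulr0 addr0.
Qed.

Lemma log_sum_exp_slope_le (x : I -> R) (p q : R) : p != 0 -> q != 0 -> p < q ->
  p^-1 * log_sum_exp (fun i => p * x i) <= q^-1 * log_sum_exp (fun i => q * x i).
Proof.
(* Exponents of equal sign: the ratio of the smaller to the larger in absolute value lies in [0, 1].
   It is applied to (p, q) when both are positive, and to (q, p) when both are negative. *)
have aux (u v : R) : 0 < `|u| <= `|v| -> 0 <= u / v ->
    log_sum_exp (fun i => u * x i) <= u / v * log_sum_exp (fun i => v * x i).
  move=> /andP[u0 uv] uv0; have v0 : v != 0.
    by rewrite -normr_gt0 (lt_le_trans u0).
  have -> : (fun i => u * x i) = (fun i => u / v * (v * x i)).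
    by apply/funext => i; rewrite mulrA divfK.
  apply: log_sum_exp_scale; rewrite uv0 -[u / v]ger0_norm // normf_div.
  by rewrite ler_pdivrMr ?mul1r // (lt_le_trans u0).
move=> p0 q0 pq.
have [p_gt0|p_le0] := ltP 0 p.
  have q_gt0 := lt_trans p_gt0 pq.
  rewrite -(ler_pM2l p_gt0) mulVKf // mulrA aux //.
    by rewrite !gtr0_norm // p_gt0 ltW.
  by rewrite divr_ge0 ?ltW.
have p_lt0 : p < 0 by rewrite lt_neqAle p0.
have [q_gt0|q_le0] := ltP 0 q.
  (* For p < 0 < q the weighted mean of [x] separates the two sides; dividing by the negative p
     reverses the Jensen bound. *)
  have mean (r : R) : r * (\sum_(i | P i) w i * x i)
      <= log_sum_exp (fun i => r * x i).
    rewrite mulr_sumr; under eq_bigr => i _ do rewrite mulrCA.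
    exact: log_sum_exp_ge_mean.
  apply: (@le_trans _ _ (\sum_(i | P i) w i * x i)).
    by rewrite -(ler_nM2l p_lt0) mulVKf.
  by rewrite -(ler_pM2l q_gt0) mulVKf.
have q_lt0 : q < 0 by rewrite lt_neqAle q0.
rewrite -(ler_nM2l q_lt0) mulVKf // mulrA aux //.
  by rewrite !ltr0_norm // lerN2 oppr_gt0 q_lt0 ltW.
by rewrite -mulrNN mulr_ge0 // oppr_ge0 ?invr_le0 ltW.
Qed.

End LogSumExp.

(** * Monotonicity of the negativities in alpha *)

Section Moments.
Variables (R : realType) (n : nat) (A : {set 'I_n}).
Implicit Types rho : 'Op[R[i]](qbits n).

Lemma sing_val_ge0 (p q : nat) (M : 'M[R[i]]_(p, q)) j : 0 <= sing_val M j.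
Proof. exact: sqrtr_ge0. Qed.

(** A nonzero singular value satisfies s^alpha = s^2 exp((2 - alpha)(- ln s)), so r_alpha is [r2]
    times a weighted average. The coefficients 1/(2 - alpha) and (1 - alpha)/(2 - alpha) of [ln r2]
    add up to 1. *)
Lemma moment_neg_log_sum_exp (rho : 'Op[R[i]](qbits n)) (alpha : R)
    (s := sing_val (realign A rho)) (r2 := realign_moment A 2 rho) :
  0 < r2 -> alpha != 2 ->
  moment_neg A alpha rho = ln r2 + (2 - alpha)^-1 *
    log_sum_exp (fun j => s j != 0) (fun j => s j ^+ 2 / r2)
      (fun j => (2 - alpha) * - ln (s j)).
Proof.
move=> r2_gt0 alphaN2; rewrite /moment_neg -/r2 /log_sum_exp.
set S := \sum_(i | _) _.
have s_gt0 j : s j != 0 -> 0 < s j.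
  by move=> sj0; rewrite lt_def sj0 sing_val_ge0.
have SE : realign_moment A alpha rho = r2 * S.
  rewrite /S mulr_sumr; apply: eq_bigr => j sj0.
  rewrite mulrA mulrCA mulfV ?gt_eqF // mulr1 -/s.
  rewrite -powR_mulrn ?sing_val_ge0 // /powR (negPf sj0) -expRD.
  by congr expR; ring.
have [j sj0] : exists j, s j != 0.
  apply/existsP; apply: contraT; rewrite negb_exists => /forallP s0.
  by move: r2_gt0; rewrite /r2 /realign_moment big1 ?ltxx // => j; rewrite (negPf (s0 j)).
have S_gt0 : 0 < S.
  rewrite /S (bigD1 j) //= ltr_wpDr //.
    by apply: sumr_ge0 => k _; rewrite mulr_ge0 ?expR_ge0 ?divr_ge0 ?sqr_ge0 ?ltW.
  by rewrite mulr_gt0 ?expR_gt0 ?divr_gt0 ?exprn_gt0 ?s_gt0.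
rewrite SE lnM ?posrE //.
have : 2 - alpha != 0 by rewrite subr_eq0 eq_sym.
by move=> ?; field.
Qed.

Lemma moment_neg_antitone rho (alpha beta : R) :
  alpha < beta -> alpha <> 2 -> beta <> 2 ->
  moment_neg A beta rho <= moment_neg A alpha rho.
Proof.
move=> ab /eqP a2 /eqP b2; set s := sing_val (realign A rho).
have r2E : realign_moment A 2 rho = \sum_(j | s j != 0) s j ^+ 2.
  by apply: eq_bigr => j _; rewrite powR_mulrn // sing_val_ge0.
(* Without nonzero singular values every moment is an empty sum, and the convention [ln 0 = 0] makes
   both sides 0. *)
have [[j sj0]|s0] := pselect (exists j, s j != 0); last first.
  suff m0 (gamma : R) : realign_moment A gamma rho = 0.
    by rewrite /moment_neg !m0 !ln0 // !mulr0.
  by apply: big1 => j sj0; case: s0; exists j.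
have r2_gt0 : 0 < realign_moment A 2 rho.
  rewrite r2E (bigD1 j) //= ltr_wpDr ?exprn_even_gt0 //.
  by apply: sumr_ge0 => k _; rewrite sqr_ge0.
rewrite !moment_neg_log_sum_exp // lerD2l log_sum_exp_slope_le //.
- by move=> k _; rewrite divr_ge0 ?sqr_ge0 ?ltW.
- by rewrite -mulr_suml -r2E mulfV ?gt_eqF.
- by rewrite subr_eq0 eq_sym.
- by rewrite subr_eq0 eq_sym.
- by rewrite ltrD2l ltrN2.
Qed.

Lemma moment_neg1 rho : moment_neg A 1 rho = ccnr_neg A rho.
Proof.
rewrite /moment_neg subrr !mul0r addr0 /ccnr_neg /trace_norm.
have -> : (2 - 1 : R) = 1 by ring.
rewrite invr1 mul1r /realign_moment [in RHS] (bigID (fun j => sing_val (realign A rho) j != 0)) /=.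
rewrite [X in _ = ln (_ + X)]big1 ?addr0; last by move=> j /negPn/eqP.
by congr ln; apply: eq_bigr => j _; rewrite powRr1 // sing_val_ge0.
Qed.

End Moments.

(** * Singular values and trace norm duality *)

Section SingularValues.
Variable R : realType.
Local Notation C := R[i].

Lemma gram_entry_ge0 (p q : nat) (N : 'M[C]_(p, q)) j : 0 <= (N ^t* *m N) j j.
Proof.
by rewrite mxE sumr_ge0 // => k _; rewrite !mxE mulrC mul_conjC_ge0.
Qed.

Lemma gram_hermitian (p q : nat) (N : 'M[C]_(p, q)) : N ^t* *m N \is hermsymmx.
Proof.
by apply/is_hermitianmxP; rewrite expr0 scale1r trmx_mul map_mxM trmxCK.
Qed.

Lemma spectral_decomposition (d : nat) (H : 'M[C]_d) : H \is hermsymmx ->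
  H = (spectralmx H) ^t* *m diag_mx (spectral_diag H) *m spectralmx H.
Proof.
move=> /hermitian_normalmx /orthomx_spectralP {1}->.
by rewrite invmx_unitary ?spectral_unitarymx.
Qed.

Lemma diag_spectral (d : nat) (H : 'M[C]_d) : H \is hermsymmx ->
  diag_mx (spectral_diag H) = spectralmx H *m H *m (spectralmx H) ^t*.
Proof.
move=> /spectral_decomposition; have := spectral_unitarymx H.
set P := spectralmx H; set D := diag_mx _ => U HE.
by rewrite HE !mulmxA (unitarymxP U) mul1mx mulmxtVK.
Qed.

(** The eigenvalues are diagonal entries of the Gram matrix of [M *m P ^t*], hence real and
    nonnegative: the real part and the square root in [sing_val] lose nothing. *)
Lemma spectral_diag_gram (p q : nat) (M : 'M[C]_(p, q)) j :
  spectral_diag (M ^t* *m M) 0 j = (sing_val M j ^+ 2)%:C.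
Proof.
set G := M ^t* *m M; set P := spectralmx G.
have DE : diag_mx (spectral_diag G) = (M *m P ^t*) ^t* *m (M *m P ^t*).
  by rewrite diag_spectral ?gram_hermitian // trmx_mul map_mxM trmxCK !mulmxA.
have d_ge0 : 0 <= spectral_diag G 0 j.
  have := gram_entry_ge0 (M *m P ^t*) j.
  by rewrite -DE mxE eqxx.
rewrite sqr_sqrtr; first by rewrite RRe_real ?ger0_real.
by move: d_ge0; rewrite lecE => /andP[].
Qed.

(* K is the adjoint of the polar part of M; the bound says that it is a
   contraction. *)
Lemma trace_norm_dual (p q : nat) (M : 'M[C]_(p, q)) :
  exists2 K : 'M[C]_(q, p), \tr (K *m M) = (trace_norm M)%:C
    & forall w : 'rV[C]_q, ((w *m K) *m (w *m K) ^t*) 0 0 <= (w *m w ^t*) 0 0.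
Proof.
set G := M ^t* *m M; set P := spectralmx G; set s := sing_val M.
have U : P \is unitarymx := spectral_unitarymx G.
(* Because [0^-1 = 0], [V] is the pseudo-inverse of the diagonal matrix of singular values. *)
pose D := diag_mx (\row_j (s j ^+ 2)%:C); pose V := diag_mx (\row_j ((s j)^-1)%:C).
have [N NN ME] : exists2 N : 'M[C]_(p, q), (N ^t* *m N = D) & (M = N *m P).
  exists (M *m P ^t*); last by rewrite mulmxKtV.
  rewrite trmx_mul map_mxM trmxCK mulmxA -(mulmxA P) -/G.
  rewrite -diag_spectral ?gram_hermitian //; congr diag_mx.
  by apply/rowP => j; rewrite mxE spectral_diag_gram.
have VV : V ^t* = V.
  apply/matrixP => i j; rewrite !mxE eq_sym; case: eqP => [->|_].
    by rewrite !mulr1n -[RHS]conjc_real.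
  by rewrite !mulr0n rmorph0.
(* With [M = N *m P], the trace of [K *m M] reduces to that of [V *m D], the sum of s^-1 s^2 = s. *)
exists (P ^t* *m V *m N ^t*).
  rewrite {1}ME mulmxA mxtrace_mulC !mulmxA (unitarymxP U) mul1mx -mulmxA NN.
  rewrite mulmx_diag mxtrace_diag /trace_norm rmorph_sum; apply: eq_bigr => j _.
  rewrite !mxE -rmorphM -/(s j); congr _%:C.
  have [->|sj0] := eqVneq (s j) 0; first by rewrite invr0 mul0r.
  by rewrite expr2 mulKf.
move=> w; set y := w *m P ^t*.
have -> : w *m w ^t* = y *m y ^t*.
  by rewrite /y trmx_mul map_mxM trmxCK mulmxA mulmxKtV.
rewrite !mulmxA -/y trmx_mul map_mxM trmxCK trmx_mul map_mxM VV.
(* This is the projection onto the nonzero singular values, so contraction amounts to dropping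
   nonnegative terms from the squared norm of [y]. *)
have VDV : V *m D *m V = diag_mx (\row_j (s j != 0)%:R).
  rewrite !mulmx_diag; congr diag_mx; apply/rowP => j; rewrite !mxE -!rmorphM.
  have [->|sj0] := eqVneq (s j) 0; first by rewrite invr0 mulr0.
  by rewrite expr2 mulKf // mulfV.
rewrite !mulmxA -(mulmxA (y *m V)) NN -!(mulmxA y) VDV mulmxA !mxE.
apply: ler_sum => j _; rewrite mul_mx_diag !mxE mulrAC.
by case: eqP => _; rewrite ?mulr0 ?mulr1 // mul_conjC_ge0.
Qed.

(** As both norms are at most 1, the termwise bound |x||u| <= (|x|^2 + |u|^2)/2 suffices. *)
Lemma cauchy_schwarz_le1 (p : nat) (x : 'rV[C]_p) (u : 'cV[C]_p) :
  (x *m x ^t*) 0 0 <= 1 -> \sum_i `|u i 0| ^+ 2 <= 1 -> `|(x *m u) 0 0| <= 1.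
Proof.
move=> x1 u1.
have {}x1 : \sum_i `|x 0 i| ^+ 2 <= 1.
  by apply: le_trans x1; rewrite mxE; apply: ler_sum => i _; rewrite !mxE normCK.
rewrite mxE; apply: le_trans (ler_norm_sum _ _ _) _.
apply: (@le_trans _ _ (\sum_i 2^-1 * (`|x 0 i| ^+ 2 + `|u i 0| ^+ 2))).
  apply: ler_sum => i _; rewrite normrM ler_pdivlMl //.
  rewrite -subr_ge0.
  have -> : `|x 0 i| ^+ 2 + `|u i 0| ^+ 2 - 2 * (`|x 0 i| * `|u i 0|)
      = (`|x 0 i| - `|u i 0|) ^+ 2 by ring.
  by rewrite real_exprn_even_ge0 // rpredB // normr_real.
rewrite -mulr_sumr big_split /= ler_pdivrMl // mulr1.
exact: (lerD x1 u1).
Qed.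

End SingularValues.

(** * Density matrices: Frobenius bound and complex span *)

Section Densities.
Variable R : realType.
Local Notation C := R[i].

Lemma hermitian_entry (d : nat) (X : 'M[C]_d) i j : X \is hermsymmx ->
  X i j = Num.conj (X j i).
Proof. by move=> /is_hermitianmxP XE; rewrite {1}XE expr0 scale1r !mxE. Qed.

(** The left side is the purity tr X^2, the sum of the squared eigenvalues; these are nonnegative
    with sum 1, so squaring does not increase them. *)
Lemma density_entries_le1 (d : nat) (X : 'M[C]_d) : density X ->
  \sum_i \sum_j `|X i j| ^+ 2 <= 1.
Proof.
move=> [Xh Xpos Xtr].
set P := spectralmx X; have U : P \is unitarymx := spectral_unitarymx X.
set D := diag_mx (spectral_diag X).
have XE : X = P ^t* *m D *m P := spectral_decomposition Xh.
have d_ge0 j : 0 <= spectral_diag X 0 j.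
  (* The quadratic form at the j-th eigenvector is the j-th eigenvalue. *)
  have := Xpos ((row j P) ^t*); rewrite trmxCK.
  have -> : spectral_diag X 0 j = D j j by rewrite mxE eqxx.
  rewrite /D diag_spectral // -/P -row_mul.
  set L := P *m X; rewrite !mxE; under eq_bigr => k _ do rewrite !mxE.
  by under [X in _ -> 0 <= X]eq_bigr => k _ do rewrite !mxE.
have d_sum : \sum_j spectral_diag X 0 j = 1.
  rewrite -Xtr {2}XE mxtrace_mulC mulmxA (unitarymxP U) mul1mx.
  by rewrite mxtrace_diag.
have -> : \sum_i \sum_j `|X i j| ^+ 2 = \tr (X *m X).
  apply: eq_bigr => i _; rewrite mxE; apply: eq_bigr => j _.
  by rewrite normCK [X j i]hermitian_entry.
have -> : \tr (X *m X) = \sum_j spectral_diag X 0 j ^+ 2.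
  have PP : P ^t* *m P = 1%:M by rewrite -[P ^t*]mul1mx mulmxKtV.
  have DD : D *m D = P *m (X *m X) *m P ^t*.
    by rewrite /D diag_spectral // !mulmxA mulmxKtV.
  have -> : \tr (X *m X) = \tr (D *m D).
    by rewrite DD [RHS]mxtrace_mulC !mulmxA PP mul1mx.
  rewrite mulmx_diag mxtrace_diag.
  by apply: eq_bigr => j _; rewrite mxE expr2.
rewrite -[leRHS]d_sum; apply: ler_sum => j _.
rewrite expr2 ler_piMl // -d_sum (bigD1 j) //= lerDl sumr_ge0 //.
Qed.

Lemma density_unit_row (d : nat) (r : 'rV[C]_d) :
  (r *m r ^t*) 0 0 = 1 -> density (r ^t* *m r).
Proof.
move=> r1; split; first exact: gram_hermitian.
  move=> v; rewrite mulmxA -mulmxA.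
  have -> : v ^t* *m r ^t* = (r *m v) ^t* by rewrite trmx_mul map_mxM.
  exact: gram_entry_ge0.
by rewrite mxtrace_mulC trace_mx11.
Qed.

(** The spectral theorem gives the pure states on the rows of [spectralmx H], weighted by the
    eigenvalues. *)
Lemma hermitian_density_span (d : nat) (H : 'M[C]_d) : H \is hermsymmx ->
  exists (c : 'I_d -> C) (X : 'I_d -> 'M[C]_d),
    (forall k, density (X k)) /\ H = \sum_k c k *: X k.
Proof.
move=> Hh; set P := spectralmx H.
exists (fun k => spectral_diag H 0 k), (fun k => (row k P) ^t* *m row k P).
split=> [k|].
  apply: density_unit_row.
  have /row_unitarymxP/(_ k k) := spectral_unitarymx H.
  by rewrite dotmxE eqxx.
rewrite [LHS]spectral_decomposition // -/P.
apply/matrixP => i j; rewrite mxE summxE; apply: eq_bigr => k _.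
by rewrite mul_mx_diag !mxE big_ord1 !mxE mulrAC mulrC mulrA.
Qed.

Lemma density_span (d : nat) (M : 'M[C]_d) :
  exists (c : 'I_d + 'I_d -> C) (X : 'I_d + 'I_d -> 'M[C]_d),
    (forall k, density (X k)) /\ M = \sum_k c k *: X k.
Proof.
pose j : C := Complex 0 1.
have jj : j * j = -1 by rewrite -expr2 sqr_i.
have jc : Num.conj j = - j by rewrite /j; simpc.
have [|c1 [X1 [X1d E1]]] := @hermitian_density_span d (M + M ^t*).
  apply/is_hermitianmxP; rewrite expr0 scale1r raddfD /= map_mxD trmxCK.
  by rewrite addrC.
have [|c2 [X2 [X2d E2]]] := @hermitian_density_span d (j *: (M - M ^t*)).
  apply/is_hermitianmxP; rewrite expr0 scale1r; apply/matrixP => a b.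
  by rewrite !mxE rmorphM rmorphB /= conjCK jc; ring.
exists (fun k => match k with inl k => 2^-1 * c1 k | inr k => - j / 2 * c2 k end).
exists (fun k => match k with inl k => X1 k | inr k => X2 k end).
split; first by case.
rewrite big_sumType /=.
under eq_bigr => k _ do rewrite -scalerA.
under [X in _ + X]eq_bigr => k _ do rewrite -scalerA.
rewrite -!scaler_sumr -E1 -E2.
apply/matrixP => a b; rewrite !mxE.
set x := M a b; set y := Num.conj _.
have -> : - j / 2 * (j * (x - y)) = - (j * j) / 2 * (x - y) by field.
by rewrite jj; field.
Qed.

End Densities.

(** * Realignment of separable states *)

Section RealignSeparable.
Variables (R : realType) (n : nat) (A : {set 'I_n}).
Local Notation C := R[i].
Local Notation B := (~: A).

Lemma restr_join_left (a : bits A) (b : bits B) : restr_bits A (join_bits a b) = a.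
Proof.
apply/ffunP => u; rewrite !ffunE; case: insubP => [v _ /val_inj -> //|].
by rewrite (valP u).
Qed.

Lemma restr_join_right (a : bits A) (b : bits B) : restr_bits B (join_bits a b) = b.
Proof.
apply/ffunP => u; rewrite !ffunE; case: insubP => [v vA vu|_].
  by have := valP u; rewrite inE -vu (valP v).
by case: insubP => [v _ /val_inj -> //|]; rewrite (valP u).
Qed.

Lemma join_restr (x : qbits n) : join_bits (restr_bits A x) (restr_bits B x) = x.
Proof.
apply/ffunP => i; rewrite !ffunE.
case: insubP => [u _ <-|iA]; first by rewrite ffunE.
by case: insubP => [u _ <-|]; rewrite ?ffunE // inE iA.
Qed.

Lemma sum_enum_val (V : nmodType) (T : finType) (F : T -> V) :
  \sum_(i < #|{: T}|) F (enum_val i) = \sum_t F t.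
Proof. by rewrite -(big_enum_val (A := T)). Qed.

Lemma density_mxat_le1 (T : finType) (X : 'Op[C](T)) : density X ->
  \sum_(i < #|{: T * T}|) `|mxat X (enum_val i).1 (enum_val i).2| ^+ 2 <= 1.
Proof.
move=> /density_entries_le1; apply: le_trans.
rewrite (sum_enum_val (fun t : T * T => `|mxat X t.1 t.2| ^+ 2)).
rewrite -(pair_big xpredT xpredT (fun x y => `|mxat X x y| ^+ 2)) /=.
rewrite -(sum_enum_val (fun x => \sum_y `|mxat X x y| ^+ 2)).
apply: ler_sum => i _; rewrite -(sum_enum_val (fun y => `|mxat X _ y| ^+ 2)).
by apply: ler_sum => j _; rewrite /mxat !enum_valK.
Qed.

Lemma realign_is_linear : linear (@realign R n A).
Proof. by move=> c X Y; apply/matrixP => i j; rewrite !mxE /mxat !mxE. Qed.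

HB.instance Definition _ := GRing.isLinear.Build C _ _ _ _ realign_is_linear.

(** Realignment collects both A labels in the row index and both B labels in the column index, so a
    product operator becomes the outer product of its flattened factors. *)
Lemma realign_tensor (X : 'Op[C](bits A)) (Y : 'Op[C](bits B)) :
  realign A (tensor_op X Y) =
    (\col_i mxat X (enum_val i).1 (enum_val i).2)
    *m (\row_j mxat Y (enum_val j).1 (enum_val j).2).
Proof.
apply/matrixP => i j; rewrite !mxE big_ord1 !mxE /mxat !mxE !enum_rankK.
by rewrite !restr_join_left !restr_join_right.
Qed.

Section Contraction.
Variable K : 'M[C]_(#|{: bits B * bits B}|, #|{: bits A * bits A}|).
Hypothesis K_contraction :
  forall w : 'rV_#|{: bits B * bits B}|,
    ((w *m K) *m (w *m K) ^t*) 0 0 <= (w *m w ^t*) 0 0.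

(** By cyclicity the trace is the scalar y K x, with x and y the flattened [X] and [Y]. Both have
    norm at most 1 by the purity bound, and K does not increase that of y. *)
Lemma contraction_tensor_le1 (X : 'Op[C](bits A)) (Y : 'Op[C](bits B)) :
  density X -> density Y -> `|\tr (K *m realign A (tensor_op X Y))| <= 1.
Proof.
move=> Xd Yd; rewrite realign_tensor mulmxA mxtrace_mulC trace_mx11 mulmxA.
apply: cauchy_schwarz_le1.
  apply: le_trans (K_contraction _) _; rewrite mxE.
  apply: le_trans (density_mxat_le1 Yd).
  by apply: ler_sum => j _; rewrite !mxE normCK.
apply: le_trans (density_mxat_le1 Xd).
by apply: ler_sum => j _; rewrite !mxE.
Qed.

Lemma contraction_separable_le1 (sigma : 'Op[C](qbits n)) :
  separable A sigma -> `|\tr (K *m realign A sigma)| <= 1.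
Proof.
move=> [m [p [X [Y [p_ge0 p1 Xd Yd ->]]]]].
rewrite linear_sum mulmx_sumr raddf_sum.
apply: le_trans (ler_norm_sum _ _ _) _.
rewrite -(rmorph1 (real_complex R)) -p1 rmorph_sum; apply: ler_sum => k _.
rewrite linearZ -scalemxAr /= mxtraceZ normrM ger0_norm ?ler0c //.
by rewrite ler_piMr ?ler0c // contraction_tensor_le1.
Qed.

End Contraction.

Lemma trace_norm_realign_le (rho rhop rhom : 'Op[C](qbits n)) (s : R) : 0 <= s ->
  separable A rhop -> separable A rhom ->
  rho = (1 + s)%:C *: rhop - s%:C *: rhom ->
  trace_norm (realign A rho) <= 2 * s + 1.
Proof.
move=> s0 sp sm rhoE.
have [K KE K1] := trace_norm_dual (realign A rho).
have s1 : 0 <= 1 + s by rewrite addr_ge0.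
have := contraction_separable_le1 K1 sp; have := contraction_separable_le1 K1 sm.
move: KE; rewrite {1}rhoE linearB /= !linearZ /= mulmxDr -!scalemxAr mulmxN.
rewrite mxtraceD !mxtraceZ raddfN mulrN /=.
set tm := \tr _; set tp := \tr _ => KE tm1 tp1.
(* The comparison runs in [C], where the nonnegative trace norm equals its own modulus and the
   triangle inequality applies to the two traces. *)
have : (trace_norm (realign A rho))%:C <= (2 * s + 1)%:C :> C.
  have tn0 : 0 <= (trace_norm (realign A rho))%:C :> C.
    by rewrite ler0c sumr_ge0 // => j _; rewrite sqrtr_ge0.
  rewrite -(ger0_norm tn0) -KE; apply: le_trans (ler_normB _ _) _.
  have normE (t : R) : 0 <= t -> `|t%:C| = t%:C :> C.
    by move=> t0; rewrite ger0_norm // ler0c.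
  rewrite !normrM !normE //.
  have -> : 2 * s + 1 = (1 + s) + s by ring.
  by rewrite [leRHS] (rmorphD (real_complex R)) lerD // ler_piMr ?ler0c.
by rewrite lecR.
Qed.

End RealignSeparable.

(** * Existence of a decomposition into separable states *)

Section ProductStateSpan.
Variables (R : realType) (n : nat) (A : {set 'I_n}).
Local Notation C := R[i].
Local Notation B := (~: A).

Lemma mxtrace_mxat (T : finType) (X : 'Op[C](T)) : \tr X = \sum_x mxat X x x.
Proof.
rewrite -(sum_enum_val (fun x => mxat X x x)).
by apply: eq_bigr => i _; rewrite /mxat enum_valK.
Qed.

Lemma mxtrace_tensor (X : 'Op[C](bits A)) (Y : 'Op[C](bits B)) :
  \tr (tensor_op X Y) = \tr X * \tr Y.
Proof.
rewrite !mxtrace_mxat big_distrlr /= pair_big /=.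
rewrite (reindex (fun ab : bits A * bits B => join_bits ab.1 ab.2)) /=.
  apply: eq_bigr => -[a b] _ /=.
  by rewrite /mxat mxE !enum_rankK /= restr_join_left restr_join_right.
apply: onW_bij; exists (fun x => (restr_bits A x, restr_bits B x)) => [[a b]|x] /=.
  by rewrite restr_join_left restr_join_right.
exact: join_restr.
Qed.

Lemma tensor_adjoint (X : 'Op[C](bits A)) (Y : 'Op[C](bits B)) :
  X \is hermsymmx -> Y \is hermsymmx -> (tensor_op X Y) ^t* = tensor_op X Y.
Proof.
move=> Xh Yh; apply/matrixP => i j; rewrite !mxE rmorphM.
by congr (_ * _); apply/esym/hermitian_entry.
Qed.

Lemma tensor_sum (I J : finType) (c : I -> C) (d : J -> C)
    (X : I -> 'Op[C](bits A)) (Y : J -> 'Op[C](bits B)) :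
  tensor_op (\sum_k c k *: X k) (\sum_l d l *: Y l) =
  \sum_k \sum_l (c k * d l) *: tensor_op (X k) (Y l).
Proof.
apply/matrixP => i j; rewrite mxE /mxat !summxE big_distrlr /=.
apply: eq_bigr => k _; rewrite summxE; apply: eq_bigr => l _.
by rewrite !mxE /mxat mulrACA.
Qed.

(** Each matrix unit |x><y| factors into the matrix units of the restrictions of x and y, since a
    bit string is determined by its two restrictions. *)
Lemma tensor_basis_sum (rho : 'Op[C](qbits n)) :
  rho = \sum_x \sum_y mxat rho x y *: tensor_op
    (delta_mx (enum_rank (restr_bits A x)) (enum_rank (restr_bits A y)))
    (delta_mx (enum_rank (restr_bits B x)) (enum_rank (restr_bits B y))).
Proof.
apply/matrixP => i j; rewrite pair_big summxE (bigD1 (enum_val i, enum_val j)) //=.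
rewrite big1 ?addr0 => [|[x y] /= xyN].
  by rewrite !mxE /mxat !mxE !eqxx /= !mulr1 !enum_valK.
rewrite !mxE /mxat !mxE !(inj_eq enum_rank_inj) -natrM mulnb.
case: andP => [[/andP[/eqP iA /eqP jA] /andP[/eqP iB /eqP jB]]|_]; last first.
  by rewrite mulr0.
case/eqP: xyN; rewrite -[x] (join_restr A) -[y] (join_restr A).
by rewrite -iA -iB -jA -jB !join_restr.
Qed.

Lemma density_basis_span (d : nat) :
  exists (c : 'I_d -> 'I_d -> 'I_d + 'I_d -> C)
         (X : 'I_d -> 'I_d -> 'I_d + 'I_d -> 'M[C]_d),
    (forall i j k, density (X i j k)) /\
    forall i j, delta_mx i j = \sum_k c i j k *: X i j k.
Proof.
have /choice[f fP] (ij : 'I_d * 'I_d) :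
    exists cX : ('I_d + 'I_d -> C) * ('I_d + 'I_d -> 'M[C]_d),
    (forall k, density (cX.2 k)) /\ delta_mx ij.1 ij.2 = \sum_k cX.1 k *: cX.2 k.
  have [c [X cX]] := density_span (delta_mx ij.1 ij.2 : 'M[C]_d).
  by exists (c, X).
exists (fun i j => (f (i, j)).1), (fun i j => (f (i, j)).2); split=> [i j|i j].
  exact: (fP (i, j)).1.
exact: (fP (i, j)).2.
Qed.

Lemma product_state_span (rho : 'Op[C](qbits n)) :
  exists (J : finType) (c : J -> C)
         (X : J -> 'Op[C](bits A)) (Y : J -> 'Op[C](bits B)),
    [/\ forall k, density (X k), forall k, density (Y k)
      & rho = \sum_k c k *: tensor_op (X k) (Y k)].
Proof.
have [c [X [Xd cX]]] := density_basis_span #|{: bits A}|.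
have [d [Y [Yd dY]]] := density_basis_span #|{: bits B}|.
pose a x := enum_rank (restr_bits A x); pose b x := enum_rank (restr_bits B x).
(* An index picks a matrix unit of the whole system and one state in the expansion of each of its
   two factors. *)
pose J := ((qbits n * qbits n) * (('I_#|{: bits A}| + 'I_#|{: bits A}|)
  * ('I_#|{: bits B}| + 'I_#|{: bits B}|)))%type.
exists J.
exists (fun t => mxat rho t.1.1 t.1.2 *
  (c (a t.1.1) (a t.1.2) t.2.1 * d (b t.1.1) (b t.1.2) t.2.2)).
exists (fun t => X (a t.1.1) (a t.1.2) t.2.1), (fun t => Y (b t.1.1) (b t.1.2) t.2.2).
split=> //; rewrite [LHS]tensor_basis_sum pair_big.
rewrite -(pair_big xpredT xpredT (fun u v =>
  (mxat rho u.1 u.2 * (c (a u.1) (a u.2) v.1 * d (b u.1) (b u.2) v.2))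
  *: tensor_op (X (a u.1) (a u.2) v.1) (Y (b u.1) (b u.2) v.2))) /=.
apply: eq_bigr => -[x y] _ /=; rewrite cX dY tensor_sum pair_big scaler_sumr /=.
by apply: eq_bigr => -[k l] _ /=; rewrite scalerA.
Qed.

(** Product states are self-adjoint, so averaging a complex expansion with its adjoint replaces each
    coefficient by its real part. *)
Lemma hermitian_product_state_span (rho : 'Op[C](qbits n)) : rho \is hermsymmx ->
  exists (J : finType) (c : J -> R)
         (X : J -> 'Op[C](bits A)) (Y : J -> 'Op[C](bits B)),
    [/\ forall k, density (X k), forall k, density (Y k)
      & rho = \sum_k (c k)%:C *: tensor_op (X k) (Y k)].
Proof.
move=> rhoh; have [J [c [X [Y [Xd Yd rhoE]]]]] := product_state_span rho.
exists J, (fun k => complex.Re (c k)), X, Y; split=> //.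
have -> : rho = 2^-1 *: (rho + rho ^t*).
  have -> : rho ^t* = rho.
    by move/is_hermitianmxP: rhoh => {2}->; rewrite expr0 scale1r.
  by apply/matrixP => i j; rewrite !mxE; field.
rewrite rhoE raddf_sum /= raddf_sum -big_split scaler_sumr; apply: eq_bigr => k _ /=.
have [Xh _ _] := Xd k; have [Yh _ _] := Yd k.
rewrite linearZ /= map_mxZ tensor_adjoint // -scalerDl scalerA ReJ_add.
by congr (_ *: _); rewrite mulrC.
Qed.

Lemma separable_finType (J : finType) (p : J -> R)
    (X : J -> 'Op[C](bits A)) (Y : J -> 'Op[C](bits B)) :
  (forall k, 0 <= p k) -> \sum_k p k = 1 ->
  (forall k, density (X k)) -> (forall k, density (Y k)) ->
  separable A (\sum_k (p k)%:C *: tensor_op (X k) (Y k)).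
Proof.
move=> p0 p1 Xd Yd; exists #|{: J}|, (p \o enum_val), (X \o enum_val), (Y \o enum_val).
split=> //=; first by rewrite sum_enum_val.
by rewrite (sum_enum_val (fun k => (p k)%:C *: tensor_op (X k) (Y k))).
Qed.

Lemma separable_normalize (J : finType) (p : J -> R)
    (X : J -> 'Op[C](bits A)) (Y : J -> 'Op[C](bits B)) :
  (forall k, 0 <= p k) -> 0 < \sum_k p k ->
  (forall k, density (X k)) -> (forall k, density (Y k)) ->
  exists2 sigma, separable A sigma &
    \sum_k (p k)%:C *: tensor_op (X k) (Y k) = (\sum_k p k)%:C *: sigma.
Proof.
move=> p0; set a := \sum_k p k => a_gt0 Xd Yd.
exists (\sum_k (p k / a)%:C *: tensor_op (X k) (Y k)).
  apply: separable_finType => // [k|]; first by rewrite divr_ge0 // ltW.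
  by rewrite -mulr_suml mulfV ?gt_eqF.
rewrite scaler_sumr; apply: eq_bigr => k _; rewrite scalerA -rmorphM.
by rewrite mulrC divfK // gt_eqF.
Qed.

(** The real coefficients of an expansion in product states sum to the trace 1. If their negative
    parts sum to s, their positive parts sum to 1 + s; normalizing both parts yields the two
    states. *)
Lemma robustness_decomposition (rho : 'Op[C](qbits n)) : density rho ->
  exists s : R, 0 <= s /\ exists rhop rhom : 'Op[C](qbits n),
    [/\ separable A rhop, separable A rhom
      & rho = (1 + s)%:C *: rhop - s%:C *: rhom].
Proof.
move=> [rhoh _ rho1].
have [J [c [X [Y [Xd Yd rhoE]]]]] := hermitian_product_state_span rhoh.
have c1 : \sum_k c k = 1.
  apply: (@complexI R); rewrite rmorph1 -rho1 rhoE rmorph_sum raddf_sum.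
  apply: eq_bigr => k _; have [_ _ X1] := Xd k; have [_ _ Y1] := Yd k.
  by rewrite /= mxtraceZ mxtrace_tensor X1 Y1 !mulr1.
pose p k := Num.max (c k) 0; pose q k := Num.max (- c k) 0.
have p0 k : 0 <= p k by rewrite le_max lexx orbT.
have q0 k : 0 <= q k by rewrite le_max lexx orbT.
have cE k : c k = p k - q k.
  rewrite /p /q; case: (leP (c k) 0) => ck.
    by rewrite max_l ?oppr_ge0 // sub0r opprK.
  by rewrite max_r ?subr0 // oppr_le0 ltW.
set s := \sum_k q k; have s0 : 0 <= s by apply: sumr_ge0.
have pE : \sum_k p k = 1 + s.
  by rewrite -c1 -big_split /=; apply: eq_bigr => k _; rewrite cE subrK.
have [|rhop sp rhopE] := separable_normalize p0 _ Xd Yd.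
  by rewrite pE ltr_pwDl.
have [rhom sm rhomE] : exists2 sigma, separable A sigma &
    \sum_k (q k)%:C *: tensor_op (X k) (Y k) = s%:C *: sigma.
  have [s_gt0|s_le0] := ltP 0 s; first exact: separable_normalize.
  (* When s = 0 there is nothing to normalize: all negative parts vanish and any separable state
     serves. *)
  exists rhop => //; have sE : s = 0 by apply/le_anti; rewrite s_le0.
  rewrite sE scale0r big1 // => k _.
  have /eqP := sE; rewrite psumr_eq0 // => /allP/(_ k).
  by rewrite mem_index_enum => /(_ isT)/eqP ->; rewrite scale0r.
exists s; split=> //; exists rhop, rhom; split=> //.
rewrite -pE -rhopE -rhomE -sumrB rhoE; apply: eq_bigr => k _.
by rewrite -scalerBl -rmorphB -cE.
Qed.

End ProductStateSpan.

(** * Robustness bound and conclusion *)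

Lemma ccnr_neg_le_robustness (R : realType) (n : nat) (A : {set 'I_n})
    (rho : 'Op[R[i]](qbits n)) : density rho ->
  ccnr_neg A rho <= ln (2 * robustness A rho + 1).
Proof.
move=> rhod; rewrite /ccnr_neg; set t := trace_norm _; set r := robustness A rho.
have t_ge0 : 0 <= t by apply: sumr_ge0 => j _; exact: sing_val_ge0.
have r_ge0 : 0 <= r.
  by apply: lb_le_inf (robustness_decomposition A rhod) _ => s [].
have tr : t <= 2 * r + 1.
  (* Solved for s, the trace norm bound makes (t - 1)/2 a lower bound of the nonempty set whose
     infimum is [r]. *)
  suff : (t - 1) / 2 <= r by rewrite ler_pdivrMr // mulrC lerBlDr.
  apply: lb_le_inf (robustness_decomposition A rhod) _ => s [s0 [rp [rm [sp sm rhoE]]]].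
  by rewrite ler_pdivrMr // mulrC lerBlDr (trace_norm_realign_le s0 sp sm).
(* For t = 0 the left side is [ln 0 = 0], while the right side is the logarithm of a number at least
   1. *)
have [t0|] := leP t 0; first by rewrite ln0 // ln_ge0 // lerDr mulr_ge0.
by move=> t_gt0; rewrite ler_ln ?posrE // (lt_le_trans t_gt0).
Qed.

Theorem mainTheorem9 (R : realType) (n : nat) (A : {set 'I_n})
    (rho : 'Op[R[i]](qbits n)) (rho_state : density rho) :
  [/\ forall alpha beta : R, 0 <= alpha -> alpha < beta ->
        alpha <> 2 -> beta <> 2 ->
        moment_neg A beta rho <= moment_neg A alpha rho,
      forall alpha : R, 1 <= alpha -> alpha <> 2 ->
        moment_neg A alpha rho <= ccnr_neg A rho
    & ccnr_neg A rho <= ln (2 * robustness A rho + 1)].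
Proof.
split=> [alpha beta _ lt_ab a2 b2|alpha a1 a2|]; first exact: moment_neg_antitone.
  rewrite -moment_neg1; move: a1; rewrite le_eqVlt => /predU1P[<- //|a1].
  by apply: moment_neg_antitone => //; apply/eqP; rewrite lt_eqF // ltr1n.
exact: ccnr_neg_le_robustness.
Qed.
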